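(* Consider SAGA with arbitrary sampling (defined in the context) with stepsize $\alpha=\min_{j}\frac{n p_j}{4v_j+n\sigma}$. Then its iteration complexity is $\max_j\left(\frac{4v_j+n\sigma}{n\sigma p_j}\right)\log\frac1\epsilon$; that is, there exists $b\in\mathbb R^n$ with positive entries such that, with $$\Psi^k=\|x^k-x^*\|^2+\alpha\sum_{j=1}^n b_j^2\left\|(\mathbf M_j^\dagger)^{1/2}\left(\nabla f_j(\phi_j^k)-\nabla f_j(x^* )\right)\right\|^2,$$ for every $\epsilon\in(0,1)$ and every integer $k\ge\max_j\left(\frac{4v_j+n\sigma}{n\sigma p_j}\right)\log\frac1\epsilon$ we have $\mathbb E[\Psi^k]\le\epsilon\,\Psi^0$.
   Context: Problem. $f_1,\dots,f_n:\mathbb R^d\to\mathbb R$ are differentiable and convex, $f=\frac1n\sum_{j=1}^n f_j$, $\psi:\mathbb R^d\to\mathbb R\cup\{+\infty\}$ is proper, closed and convex. $\min_x f(x)+\psi(x)$ has a unique minimizer $x^*$, and $f$ is $\sigma$-quasi strongly convex with $\sigma>0$: $f(x^* )\ge f(y)+\langle\nabla f(y),x^*-y\rangle+\frac\sigma2\|y-x^*\|^2$ for all $y$. Each $f_j$ is $\mathbf M_j$-smooth, $\mathbf M_j\succeq0$ symmetric: $f_j(x)\le f_j(y)+\langle\nabla f_j(y),x-y\rangle+\frac12(x-y)^\top\mathbf M_j(x-y)$ for all $x,y$. $\mathrm{prox}_{\alpha\psi}(x)=\arg\min_u\{\alpha\psi(u)+\frac12\|u-x\|^2\}$; $\dagger$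 is the Moore–Penrose pseudoinverse. Sampling. $R$ is a random subset of $[n]=\{1,\dots,n\}$ with arbitrary distribution such that $p_j=\mathbb P(j\in R)>0$ for all $j$. The vector $v\in\mathbb R^n$ satisfies $\mathbb E\left[\left\|\sum_{j\in R}\mathbf M_j^{1/2}h_j\right\|^2\right]\le\sum_{j=1}^n p_jv_j\|h_j\|^2$ for all $h_1,\dots,h_n\in\mathbb R^d$. Algorithm (SAGA with arbitrary sampling). Given $x^0\in\mathbb R^d$, set $\phi_j^0=x^0$ for all $j$. For $k=0,1,2,\dots$: draw $R^k$, a copy of $R$ independent of the past; set $\phi_j^{k+1}=x^k$ if $j\in R^k$ and $\phi_j^{k+1}=\phi_j^k$ otherwise; $g^k=\frac1n\sum_{j=1}^n\nabla f_j(\phi_j^k)+\sum_{j\in R^k}\frac1{np_j}\left(\nabla f_j(\phi_j^{k+1})-\nabla f_j(\phi_j^k)\right)$; $x^{k+1}=\mathrm{prox}_{\alpha\psi}(x^k-\alpha g^k)$. Standing assumption. For all $k$ and all $j$: $\nabla f_j(x^k)-\nabla f_j(x^* )=\mathbf M_j^\dagger\mathbf M_j(\nabla f_j(x^k)-\nabla f_j(x^* ))$ and $\nabla f_j(\phi_j^k)-\nabla f_j(x^* )=\mathbf M_j^\dagger\mathbf M_j(\nabla f_j(\phi_j^k)-\nabla f_j(x^* ))$. *)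

(* Defs.v *)
From HB Require Import structures.
From mathcomp Require Import all_boot all_order all_algebra.
From mathcomp Require Import all_classical all_reals all_analysis.
Set Implicit Arguments.
Unset Strict Implicit.
Unset Printing Implicit Defensive.
Import Order.TTheory GRing.Theory Num.Theory.
Import numFieldNormedType.Exports.
Local Open Scope classical_set_scope.
Local Open Scope ring_scope.

Section euclidean.
Context {R : realType} {d : nat}.
Implicit Types (x y : 'cV[R]_d) (M X : 'M[R]_d) (f : 'cV[R]_d -> R).

Definition dotp x y : R := \sum_(i < d) x i 0 * y i 0.

(* The library norm `|x| on matrices is the sup norm; this is the Euclidean
   one (the two are equivalent, so differentiability is unaffected). *)
Definition enorm x : R := Num.sqrt (dotp x x).

Definition grad f x : 'cV[R]_d := \col_(i < d) 'D_(delta_mx i 0) f x.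

Definition psdmx M : Prop := M^T = M /\ forall x, 0 <= dotp x (M *m x).

(* Choice operators: on the matrices they are used for (M positive
   semidefinite), the sets below are singletons. *)
Definition sqrtmx M : 'M[R]_d := xget 0 [set X | psdmx X /\ X *m X = M].

(* The four Penrose equations. *)
Definition mpinv M : 'M[R]_d :=
  xget 0 [set X | [/\ M *m X *m M = M, X *m M *m X = X,
                      (M *m X)^T = M *m X & (X *m M)^T = X *m M]].

Definition matrix_smooth M f : Prop := forall x y,
  f x <= f y + dotp (grad f y) (x - y) + 2^-1 * dotp (x - y) (M *m (x - y)).

Definition quasi_strongly_convex (sigma : R) f (xs : 'cV[R]_d) : Prop :=
  forall y, f y + dotp (grad f y) (xs - y) + sigma / 2 * enorm (y - xs) ^+ 2
            <= f xs.

Local Open Scope ereal_scope.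
Implicit Types (psi F : 'cV[R]_d -> \bar R).

Definition eproper psi : Prop :=
  (forall x, psi x != -oo) /\ (exists x, psi x < +oo).

Definition eclosed psi : Prop :=
  closed [set xt : 'cV[R]_d * R | psi xt.1 <= xt.2%:E].

Definition econvex psi : Prop := forall (t : R) x y, (0 <= t <= 1)%R ->
  psi (t *: x + (1 - t) *: y)%R <= t%:E * psi x + (1 - t)%:E * psi y.

Definition minimizer F (xs : 'cV[R]_d) : Prop := forall y, F xs <= F y.

Definition unique_minimizer F (xs : 'cV[R]_d) : Prop :=
  minimizer F xs /\ forall z, minimizer F z -> z = xs.

(* The argmin is a singleton for alpha > 0 and psi proper, closed, convex. *)
Definition prox (alpha : R) psi x : 'cV[R]_d :=
  xget x (minimizer (fun u =>
    alpha%:E * psi u + (2^-1 * enorm (u - x) ^+ 2)%:E)).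

End euclidean.

Definition min_ord {R : realType} {n : nat} (F : 'I_n.+1 -> R) : R :=
  \big[Num.min/F ord0]_(j < n.+1) F j.

Definition max_ord {R : realType} {n : nat} (F : 'I_n.+1 -> R) : R :=
  \big[Num.max/F ord0]_(j < n.+1) F j.

Section sampling.
Context {disp : measure_display} {T : measurableType disp} {R : realType}.
Context (P : probability T R) {n : nat}.
Implicit Types (S : T -> {set 'I_n}) (Rs : nat -> T -> {set 'I_n}).

Definition random_subset S : Prop :=
  forall A : {set 'I_n}, measurable (S @^-1` [set A]).

Definition inclusion_prob S (j : 'I_n) : R := fine (P [set w | j \in S w]).

Definition same_law S S' : Prop :=
  forall A : {set 'I_n}, P (S @^-1` [set A]) = P (S' @^-1` [set A]).

(* As the random subsets take finitely many values, independence is tested on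
   the atoms of the sigma-algebras they generate; [h] is a possible history. *)
Definition independent_of_past Rs : Prop :=
  forall (k : nat) (h : nat -> {set 'I_n}) (A : {set 'I_n}),
  let past := [set w | forall i, (i < k)%N -> Rs i w = h i] in
  P (past `&` Rs k @^-1` [set A]) = (P past * P (Rs k @^-1` [set A]))%E.

End sampling.

Section saga.
Context {R : realType} {n d : nat}.
Implicit Types (f : 'I_n -> 'cV[R]_d -> R) (psi : 'cV[R]_d -> \bar R).
Implicit Types (M : 'I_n -> 'M[R]_d) (p b : 'I_n -> R) (alpha : R).

Definition favg f (x : 'cV[R]_d) : R := n%:R^-1 * \sum_(j < n) f j x.

(* The pair (x, phi). *)
Definition saga_state : Type := ('cV[R]_d * ('I_n -> 'cV[R]_d))%type.

Definition saga_init (x0 : 'cV[R]_d) : saga_state := (x0, fun=> x0).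

Definition saga_step f psi p alpha (s : saga_state) (A : {set 'I_n})
    : saga_state :=
  let x := s.1 in
  let phi := s.2 in
  let phi' j := if j \in A then x else phi j in
  let g := n%:R^-1 *: \sum_(j < n) grad (f j) (phi j)
           + \sum_(j in A) (n%:R * p j)^-1 *:
               (grad (f j) (phi' j) - grad (f j) (phi j)) in
  (prox alpha psi (x - alpha *: g), phi').

Fixpoint saga f psi p alpha (x0 : 'cV[R]_d) (A : nat -> {set 'I_n}) (k : nat)
    : saga_state :=
  if k is k'.+1 then saga_step f psi p alpha (saga f psi p alpha x0 A k') (A k')
  else saga_init x0.

Definition lyapunov f M alpha b (xs : 'cV[R]_d) (s : saga_state) : R :=
  enorm (s.1 - xs) ^+ 2 + alpha * \sum_(j < n) b j ^+ 2 *
    enorm (sqrtmx (mpinv (M j)) *m (grad (f j) (s.2 j) - grad (f j) xs)) ^+ 2.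

Definition in_range f M (xs : 'cV[R]_d) (j : 'I_n) (y : 'cV[R]_d) : Prop :=
  let u := grad (f j) y - grad (f j) xs in u = mpinv (M j) *m M j *m u.

End saga.

(* Main.v *)
Require Import Defs.
From HB Require Import structures.
From mathcomp Require Import all_boot all_order all_algebra.
From mathcomp Require Import all_classical all_reals all_analysis.
From mathcomp Require Import measurable_realfun complex ring lra.
Import Order.TTheory GRing.Theory Num.Theory.
Import numFieldNormedType.Exports.
Local Open Scope classical_set_scope.
Local Open Scope ring_scope.

(** Write [q_j a = <a, M_j^+ a>], [a_j = grad f_j x - grad f_j xs] and
    [c_j = grad f_j phi_j - grad f_j xs]. Nonexpansiveness of the proximal
    operator, whose fixed-point equation at [xs] is the optimality condition,
    bounds [|x' - xs|^2] by [|x - xs - alpha (U - (W - E W))|^2] with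
    [U = sum_(j in R) a_j / (n p_j)] and [W = sum_(j in R) c_j / (n p_j)].
    In expectation the cross term is controlled by quasi strong convexity and
    [f_j x - f_j xs - <grad f_j xs, x - xs> >= q_j a_j / 2], and the ESO bounds
    [E |U|^2] and [E |W|^2] by [sum_j v_j / (n^2 p_j) q_j]. With
    [b_j^2 = 1 / (2 n p_j)] the choice of [alpha] cancels all remaining terms
    and the Lyapunov function contracts by [1 - alpha sigma] per step. *)

(** * The Euclidean inner product on column vectors *)

Section dotp_theory.
Set Implicit Arguments. Unset Strict Implicit.
Context {R : realType} {d : nat}.
Implicit Types (x y z : 'cV[R]_d) (A : 'M[R]_d) (a : R).

Lemma dotpE x y : dotp x y = (x^T *m y) 0 0.
Proof. by rewrite !mxE; apply: eq_bigr => i _; rewrite !mxE. Qed.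

Lemma dotpC x y : dotp x y = dotp y x.
Proof. by apply: eq_bigr => i _; rewrite mulrC. Qed.

Lemma dotpDl x y z : dotp (x + y) z = dotp x z + dotp y z.
Proof. by rewrite !dotpE linearD mulmxDl mxE. Qed.

Lemma dotpDr x y z : dotp z (x + y) = dotp z x + dotp z y.
Proof. by rewrite dotpC dotpDl !(dotpC z). Qed.

Lemma dotpZl a x z : dotp (a *: x) z = a * dotp x z.
Proof. by rewrite !dotpE linearZ -scalemxAl mxE. Qed.

Lemma dotpZr a x z : dotp z (a *: x) = a * dotp z x.
Proof. by rewrite dotpC dotpZl dotpC. Qed.

Lemma dotpNl x z : dotp (- x) z = - dotp x z.
Proof. by rewrite -scaleN1r dotpZl mulN1r. Qed.

Lemma dotpNr x z : dotp z (- x) = - dotp z x.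
Proof. by rewrite dotpC dotpNl dotpC. Qed.

Lemma dotpBl x y z : dotp (x - y) z = dotp x z - dotp y z.
Proof. by rewrite dotpDl dotpNl. Qed.

Lemma dotpBr x y z : dotp z (x - y) = dotp z x - dotp z y.
Proof. by rewrite dotpDr dotpNr. Qed.

Definition dotp_lin := (dotpDl, dotpDr, dotpNl, dotpNr, dotpZl, dotpZr).

Lemma dotp0l z : dotp 0 z = 0.
Proof. by rewrite -(scale0r 0) dotpZl mul0r. Qed.

Lemma dotp0r z : dotp z 0 = 0.
Proof. by rewrite dotpC dotp0l. Qed.

Lemma dotp_suml I (r : seq I) (P : pred I) (F : I -> 'cV[R]_d) z :
  dotp (\sum_(i <- r | P i) F i) z = \sum_(i <- r | P i) dotp (F i) z.
Proof.
apply: (big_ind2 (fun u v => dotp u z = v)) => //; first exact: dotp0l.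
by move=> x1 x2 y1 y2 <- <-; rewrite dotpDl.
Qed.

Lemma dotp_ge0 x : 0 <= dotp x x.
Proof. by apply: sumr_ge0 => i _; rewrite -expr2 sqr_ge0. Qed.

Lemma dotp_eq0 x : dotp x x = 0 -> x = 0.
Proof.
move=> /eqP; rewrite psumr_eq0 => [/allP h|i _]; last by rewrite -expr2 sqr_ge0.
apply/matrixP => i j; rewrite !mxE ord1; apply/eqP.
by have := h i (mem_index_enum i); rewrite /= -expr2 sqrf_eq0.
Qed.

Lemma dotp_mulmx A x y : dotp x (A *m y) = dotp (A^T *m x) y.
Proof. by rewrite !dotpE trmx_mul trmxK mulmxA. Qed.

Lemma enorm_sqr x : enorm x ^+ 2 = dotp x x.
Proof. by rewrite /enorm sqr_sqrtr ?dotp_ge0. Qed.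

Lemma sqr_coord_le_dotp x i : x i 0 ^+ 2 <= dotp x x.
Proof.
rewrite /dotp (bigD1 i) //= -expr2 lerDl.
by apply: sumr_ge0 => j _; rewrite -expr2 sqr_ge0.
Qed.

End dotp_theory.

(** * Square roots and pseudoinverses by polynomial functional calculus *)

Section psd_functional_calculus.
Set Implicit Arguments. Unset Strict Implicit.
Context {R : realType}.

(** Newton interpolation: a new node is fitted with a multiple of the product [w], which vanishes at
    the earlier nodes only. On a spectrum, any scalar function thus becomes a polynomial. *)
Lemma poly_interpolation (g : R -> R) (s : seq R) :
  exists q : {poly R}, {in s, forall l, q.[l] = g l}.
Proof.
elim: s => [|l s [q qP]]; first by exists 0.
have [ls|ls] := boolP (l \in s).
  by exists q => m; rewrite inE => /predU1P[->|/qP//]; rewrite qP.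
pose w := \prod_(m <- s) ('X - m%:P).
have wl : w.[l] != 0 by rewrite -/(root w l) root_prod_XsubC.
exists (q + ((g l - q.[l]) / w.[l])%:P * w) => m.
rewrite inE !hornerE => /predU1P[->|ms]; first by rewrite divfK // subrKC.
have /rootP -> : root w m by rewrite root_prod_XsubC.
by rewrite mulr0 addr0 qP.
Qed.

Local Notation toC := (real_complex R).

(** Over the complex numbers [M] is Hermitian, hence unitarily diagonalizable with real eigenvalues,
    and [q] acts on the diagonal entrywise. Polynomial identities in [M] can then be checked on
    scalars. *)
Lemma symmetric_spectrum d (M : 'M[R]_d.+1) : M^T = M ->
  exists s : seq R, {in s, forall l, eigenvalue M l} /\
    forall q : {poly R}, {in s, forall l, q.[l] = 0} -> horner_mx M q = 0.
Proof.
move=> Msym; pose MC := map_mx toC M.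
have MCh : MC \is hermsymmx.
  apply: realsym_hermsym; last by apply/mxOverP => i j; rewrite mxE complex_real.
  apply/is_hermitianmxP; rewrite expr0 scale1r map_mx_id //.
  by rewrite /MC -{1}Msym map_trmx.
have MCE := orthomx_spectralP (hermitian_normalmx MCh).
have Punit := spectral_unit MC.
have /mxOverP Dreal := hermitian_spectral_diag_real MCh.
set U := spectralmx MC in MCE Punit; set D := spectral_diag MC in MCE Dreal.
exists [seq complex.Re (D 0 i) | i <- enum 'I_d.+1]; split=> [l /mapP[i _ ->]|q qP].
  rewrite -(eigenvalue_map toC) /= RRe_real; last exact: Dreal.
  (* The rows of [U] are left eigenvectors, nonzero because [U] is invertible. *)
  apply/eigenvalueP; exists (row i U); last first.
    apply/eqP => U0; move: Punit; rewrite -row_free_unit => /row_freeP[V VP].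
    have := congr1 (row i) VP; rewrite row_mul U0 mul0mx => /rowP/(_ i).
    by rewrite !mxE eqxx => /eqP; rewrite eq_sym oner_eq0.
  rewrite -/MC MCE -row_mul -!mulmxA mulKVmx //.
  by rewrite row_mul row_diag_mx -scalemxAl -rowE.
apply: (map_mx_inj (f := toC)); rewrite map_horner_mx -/MC MCE map_mx0.
rewrite (horner_mx_uconjC (map_poly toC q) (diag_mx D) Punit) horner_mx_diag.
rewrite (_ : map_mx _ _ = 0) ?linear0 ?mulmx0 ?mul0mx //.
apply/rowP => i; rewrite !mxE -(RRe_real (Dreal 0 i)) horner_map /=.
rewrite (qP (complex.Re (D 0 i))) ?rmorph0 //.
by apply: (map_f (fun i => complex.Re (D 0 i))); rewrite mem_enum.
Qed.

Lemma trmx_horner_mx d (M : 'M[R]_d.+1) (q : {poly R}) :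
  M^T = M -> (horner_mx M q)^T = horner_mx M q.
Proof.
move=> Msym; elim/poly_ind: q => [|q c IH]; first by rewrite rmorph0 trmx0.
rewrite rmorphD rmorphM /= horner_mx_X horner_mx_C linearD /= tr_scalar_mx.
rewrite trmx_mul Msym IH; congr (_ + _).
by apply/comm_mx_horner/comm_mx_refl.
Qed.

Lemma psd_eigenvalue_ge0 d (M : 'M[R]_d) l :
  psdmx M -> eigenvalue M l -> 0 <= l.
Proof.
move=> [Msym Mpos] /eigenvalueP[u uM u0].
have ut0 : 0 < dotp u^T u^T.
  rewrite lt_neqAle dotp_ge0 andbT eq_sym; apply: contra u0 => /eqP /dotp_eq0.
  by move/(congr1 trmx); rewrite trmxK trmx0 => ->.
have := Mpos u^T.
by rewrite -Msym -trmx_mul uM linearZ dotpZr pmulr_lge0.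
Qed.

Lemma sqrtmx_spec d (M : 'M[R]_d) :
  psdmx M -> psdmx (sqrtmx M) /\ sqrtmx M *m sqrtmx M = M.
Proof.
move=> Mpsd; rewrite /sqrtmx.
suff [X XP] : exists X, [set X | psdmx X /\ X *m X = M] X by exact: (xgetI _ XP).
(* [horner_mx] needs a nonzero dimension, so empty matrices are treated apart. *)
case: d M Mpsd => [|d] M Mpsd.
  exists 0; split; last by rewrite !flatmx0.
  by split=> [|x]; rewrite ?trmx0 // mul0mx dotp0r.
have [s [sM sP]] := symmetric_spectrum Mpsd.1.
(* The fourth root is interpolated: the candidate root of [M] is the square of a symmetric matrix,
   hence visibly positive semidefinite. *)
have [q qP] := poly_interpolation (fun l => Num.sqrt (Num.sqrt l)) s.
have hsym := trmx_horner_mx q Mpsd.1.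
exists (horner_mx M q *m horner_mx M q); split; first split.
- by rewrite trmx_mul hsym.
- by move=> x; rewrite -mulmxA dotp_mulmx hsym dotp_ge0.
apply/eqP; rewrite -subr_eq0 -[X in _ - X]horner_mx_X.
rewrite -[_ *m _]/(horner_mx M q * horner_mx M q * (horner_mx M q * horner_mx M q)).
rewrite -!rmorphM -rmorphB /= sP // => l ls.
rewrite !(hornerD, hornerN, hornerM, hornerX) qP //.
have l_ge0 := psd_eigenvalue_ge0 Mpsd (sM _ ls).
by rewrite -!expr2 !sqr_sqrtr ?sqrtr_ge0 // subrr.
Qed.

Definition penrose d (M X : 'M[R]_d) :=
  [/\ M *m X *m M = M, X *m M *m X = X,
      (M *m X)^T = M *m X & (X *m M)^T = X *m M].

(** The projectors agree, [M X = M Y] and [X M = Y M], so [X = X M X = X M Y = Y M Y = Y]. *)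
Lemma penrose_unique d (M X Y : 'M[R]_d) : penrose M X -> penrose M Y -> X = Y.
Proof.
move=> [mx1 mx2 mx3 mx4] [my1 my2 my3 my4].
have eMX : M *m X = M *m Y.
  by rewrite -{1}my1 -(mulmxA _ M X) -my3 -mx3 -trmx_mul mulmxA mx1 my3.
have eXM : X *m M = Y *m M.
  rewrite -{1}my1 !mulmxA -(mulmxA _ Y M) -my4 -mx4 -trmx_mul.
  by rewrite -mulmxA (mulmxA M) mx1 my4.
by rewrite -mx2 -mulmxA eMX mulmxA eXM my2.
Qed.

(** Existence comes from a polynomial in [M]. The transpose of a Penrose inverse of a symmetric
    matrix is another one, so uniqueness gives symmetry; positivity follows from [X = X M X]. *)
Lemma mpinv_spec d (M : 'M[R]_d) :
  psdmx M -> penrose M (mpinv M) /\ psdmx (mpinv M).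
Proof.
move=> Mpsd; have Msym := Mpsd.1.
have pM : penrose M (mpinv M).
  rewrite /mpinv; suff [X XP] : exists X, penrose M X by exact: (xgetI _ XP).
  case: d M Mpsd Msym => [|d] M Mpsd Msym.
    by exists 0; split; rewrite !(mulmx0, mul0mx) ?trmx0 ?flatmx0.
  have [s [sM sP]] := symmetric_spectrum Msym.
  (* With the convention [0^-1 = 0] this is already the scalar pseudoinverse. *)
  have [q qP] := poly_interpolation (fun l => l^-1) s.
  have hsym := trmx_horner_mx q Msym.
  have hC : horner_mx M q *m M = M *m horner_mx M q.
    exact/comm_horner_mx/comm_mx_refl.
  have id_l (l : R) : l * l^-1 * l = l.
    by have [->|?] := eqVneq l 0; rewrite ?mulr0 // divfK.
  exists (horner_mx M q); split; try by rewrite trmx_mul Msym hsym hC.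
    have : horner_mx M ('X * q * 'X - 'X) = 0.
      apply: sP => l ls; rewrite !(hornerD, hornerN, hornerM, hornerX) qP //.
      by rewrite id_l subrr.
    by rewrite rmorphB !rmorphM /= horner_mx_X => /subr0_eq.
  have : horner_mx M (q * 'X * q - q) = 0.
    apply: sP => l ls; rewrite !(hornerD, hornerN, hornerM, hornerX) qP //.
    by have := id_l l^-1; rewrite invrK => ->; rewrite subrr.
  by rewrite rmorphB !rmorphM /= horner_mx_X => /subr0_eq.
split=> //; have [m1 m2 m3 m4] := pM.
have Xsym : (mpinv M)^T = mpinv M.
  apply: (penrose_unique (M := M)) => //; split.
  - by have := congr1 trmx m1; rewrite !trmx_mul Msym mulmxA.
  - by have := congr1 trmx m2; rewrite !trmx_mul Msym mulmxA.
  - by rewrite trmx_mul trmxK Msym -m4 trmx_mul Msym.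
  - by rewrite trmx_mul trmxK Msym -m3 trmx_mul Msym.
split=> // x; rewrite -m2 -!mulmxA dotp_mulmx Xsym; exact: Mpsd.2.
Qed.

End psd_functional_calculus.

(** * First-order consequences of convexity and smoothness *)

Section first_order.
Set Implicit Arguments. Unset Strict Implicit.
Context {R : realType} {d : nat}.
Implicit Types (x y z v : 'cV[R]_d) (f : 'cV[R]_d -> R).

(** The derivative is the limit of the right difference quotients, so increments with [0 < t <= 1],
    the ones convexity along a segment controls, are enough. *)
Lemma derive_le f x v (c : R) : derivable f x v ->
  (forall t, 0 < t <= 1 -> f (x + t *: v) - f x <= t * c) -> 'D_v f x <= c.
Proof.
move=> fv fc.
have /cvgr_to_le : (fun h => h^-1 *: ((f \o shift x) (h *: v) - f x)) @ (0:R)^'+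
    --> 'D_v f x by exact: cvg_dnbhs_at_right.
apply.
near=> h; have h0 : 0 < h by near: h; exact: nbhs_right_gt.
have : 0 < h <= 1 by rewrite h0; near: h; exact: nbhs_right_le.
move=> /fc fh; rewrite -[X in X <= _]/(h^-1 * (f (h *: v + x) - f x)).
by rewrite [h *: v + x]addrC mulrC ler_pdivrMr // mulrC.
Unshelve. all: by end_near. Qed.

Lemma derive_ge f x v (c : R) : derivable f x v ->
  (forall t, 0 < t <= 1 -> t * c <= f (x + t *: v) - f x) -> c <= 'D_v f x.
Proof.
move=> fv fc; rewrite -lerN2 -deriveN //; apply: derive_le => [|t t01].
  exact: derivableN.
by rewrite mulrN -[leLHS]/(- f (x + t *: v) - - f x) -opprD lerN2 fc.
Qed.

Lemma derive_grad f x v : differentiable f x -> 'D_v f x = dotp (grad f x) v.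
Proof.
move=> df; rewrite deriveE //.
rewrite {1}(_ : v = \sum_(i < d) v i 0 *: delta_mx i 0); last first.
  by rewrite [LHS]matrix_sum_delta; apply: eq_bigr => i _; rewrite big_ord1.
rewrite linear_sum /dotp; apply: eq_bigr => i _.
by rewrite linearZ /= mxE deriveE // mulrC.
Qed.

Lemma convex_first_order f x y : convex_function [set: 'cV[R]_d] f ->
  differentiable f x -> f x + dotp (grad f x) (y - x) <= f y.
Proof.
move=> fcvx df; rewrite -derive_grad // -lerBrDl.
apply: derive_le => [|t /andP[t0 t1]]; first exact: diff_derivable.
have := fcvx (Itv01 (ltW t0) t1) y x (in_setT _) (in_setT _).
rewrite [X in f X](_ : _ = x + t *: (y - x)).
  rewrite convRE /= /unstable.onem => h; nra.
by rewrite /conv /= /unstable.onem scalerBl scale1r scalerBr [RHS]addrC addrAC addrA.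
Qed.

(* The upper bound of smoothness and the lower bound of convexity meet at the
   point [x - M^+ a]. *)
Lemma bregman_lower_bound f (M : 'M[R]_d) x z (a := grad f x - grad f z) :
  psdmx M -> convex_function [set: 'cV[R]_d] f -> (forall y, differentiable f y) ->
  matrix_smooth M f ->
  2^-1 * dotp a (mpinv M *m a) <= f x - f z - dotp (grad f z) (x - z).
Proof.
move=> Mpsd fcvx df fsm; have [[_ XMX _ _] [Xsym _]] := mpinv_spec Mpsd.
pose w := mpinv M *m a.
have lb := convex_first_order (x - w) fcvx (df z).
have := fsm (x - w) x.
rewrite [x - w - x]addrAC subrr sub0r mulmxN !dotpNl !dotpNr opprK.
(* By [X M X = X] for [X = mpinv M], the quadratic term cancels half of the linear gain. *)
have -> : dotp w (M *m w) = dotp a w.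
  by rewrite /w -{1}Xsym -dotp_mulmx !mulmxA XMX.
have -> : dotp a w = dotp (grad f x) w - dotp (grad f z) w by rewrite dotpBl.
move: lb; rewrite [x - w - z]addrAC (dotpBr (x - z) w).
move=> h1 h2; lra.
Qed.

End first_order.

(** * Existence, optimality and nonexpansiveness for the proximal operator *)

Section proximal.
Set Implicit Arguments. Unset Strict Implicit.
Context {R : realType} {d : nat}.
Implicit Types (x y z u w g : 'cV[R]_d) (psi : 'cV[R]_d -> \bar R).

Lemma econvexP psi (r s t : R) x y : econvex psi -> 0 <= t <= 1 ->
  (psi x <= r%:E)%E -> (psi y <= s%:E)%E ->
  (psi (t *: x + (1 - t) *: y)%R <= (t * r + (1 - t) * s)%:E)%E.
Proof.
move=> cvx t01 xr ys; apply: (le_trans (cvx t x y t01)).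
have /andP[t0 t1] := t01.
by rewrite [leRHS]EFinD; apply: leeD; rewrite EFinM lee_wpmul2l // lee_fin ?subr_ge0.
Qed.

(** Each coordinate is bounded by the Euclidean norm, so a Euclidean Cauchy estimate passes to the
    sup norm, for which the space is complete. *)
Lemma dotp_norm_cauchy (w : nat -> 'cV[R]_d) :
  (forall k l, dotp (w k - w l) (w k - w l) <= harmonic k + harmonic l) ->
  cvg (w @ \oo).
Proof.
move=> wC; apply/cauchy_cvgP/cauchy_exP => e e0 /=.
have /filter_ex[N hN] : \forall N \near \oo, @harmonic R N < e ^+ 2 / 2.
  by apply: (cvgr_lt _ cvg_harmonic); rewrite divr_gt0 // exprn_gt0.
exists (w N); exists N => // k /= Nk; split=> // i j.
rewrite ord1 /ball /= -(ltr_pXn2r (_ : (0 < 2)%N)) ?nnegrE ?normr_ge0 ?(ltW e0) //.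
rewrite -normrX ger0_norm ?sqr_ge0 //.
have := sqr_coord_le_dotp (w N - w k) i; rewrite !mxE => /le_lt_trans; apply.
apply: (le_lt_trans (wC N k)); rewrite [ltRHS]splitr ltrD //.
by apply: le_lt_trans hN; rewrite /= lef_pV2 ?posrE ?ltr0n // ler_nat ltnS.
Qed.

(** The weight [1 - 2^-1] matches the midpoint produced by [econvex]. *)
Lemma dotp_midpoint x y :
  dotp (2^-1 *: x + (1 - 2^-1) *: y) (2^-1 *: x + (1 - 2^-1) *: y) =
  2^-1 * dotp x x + 2^-1 * dotp y y - 4^-1 * dotp (x - y) (x - y).
Proof. by rewrite !dotp_lin (dotpC y x); field. Qed.

(* A minimizing sequence of the strongly convex objective is Cauchy, by the
   parallelogram identity, and [psi] is lower semicontinuous. *)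
Lemma prox_minimizer (alpha c : R) psi x g : 0 < alpha ->
  eproper psi -> eclosed psi -> econvex psi ->
  (forall w, ((c + dotp g w)%:E <= psi w)%E) ->
  minimizer (fun u => alpha%:E * psi u + (2^-1 * enorm (u - x) ^+ 2)%:E)%E
    (prox alpha psi x).
Proof.
move=> a0 [psiNy [x1 psix1]] clo cvx minor; rewrite /prox.
suff [u uP] : exists u, minimizer
    (fun u => alpha%:E * psi u + (2^-1 * enorm (u - x) ^+ 2)%:E)%E u.
  exact: (xgetI _ uP).
pose val (w : 'cV[R]_d) (t : R) := alpha * t + 2^-1 * dotp (w - x) (w - x).
(* Ranging over the epigraph of [psi] keeps the infimum in the reals. *)
pose E := [set r : R | exists w t, (psi w <= t%:E)%E /\ r = val w t].
have Einf : has_inf E.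
  split.
    exists (val x1 (fine (psi x1))), x1, (fine (psi x1)).
    by rewrite fineK // fin_numE psiNy lt_eqF.
  (* The bound results from inserting the affine minorant and completing the square in
     [w - x + alpha *: g]. *)
  exists (alpha * c + alpha * dotp g x - 2^-1 * alpha ^+ 2 * dotp g g).
  move=> r [w [t [wt ->]]].
  have := le_trans (minor w) wt; rewrite lee_fin -(ler_pM2l a0) => h.
  have := dotp_ge0 (w - x + alpha *: g).
  have gw : dotp g w = dotp g (w - x) + dotp g x by rewrite -dotpDr subrK.
  move: h; rewrite /val gw; move: (w - x) => D.
  by rewrite !dotp_lin (dotpC D g); nra.
pose m := inf E.
have mP w t : (psi w <= t%:E)%E -> m <= val w t.
  by move=> wt; apply: (ge_inf Einf.2); exists w, t.
(* Comparing [m] with the value at a midpoint leaves one eighth of the squared distance, so an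
   excess of [4^-1 * harmonic k] is what [dotp_norm_cauchy] asks for. *)
have /choice[wt wtP] k : exists wt : 'cV[R]_d * R,
    (psi wt.1 <= wt.2%:E)%E /\ val wt.1 wt.2 < m + 4^-1 * harmonic k.
  have [|r [w [t [psiw ->]]] rm] := inf_adherent (_ : 0 < 4^-1 * harmonic k) Einf.
    by rewrite mulr_gt0 ?invr_gt0 // harmonic_gt0.
  by exists (w, t).
have wcvg : cvg ((fun k => (wt k).1) @ \oo).
  apply: dotp_norm_cauchy => k l.
  have [psik valk] := wtP k; have [psil vall] := wtP l.
  have h01 : 0 <= (2^-1 : R) <= 1 by lra.
  have := mP _ _ (econvexP cvx h01 psik psil); move: valk vall; rewrite /val.
  set u := (wt k).1; set v := (wt l).1; set s := (wt k).2; set t := (wt l).2.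
  rewrite [_ *: u + _ *: v - x](_ : _ = 2^-1 *: (u - x) + (1 - 2^-1) *: (v - x)).
    rewrite dotp_midpoint (_ : u - x - (v - x) = u - v); last first.
      by rewrite opprB addrA subrK.
    by move: (harmonic k) (harmonic l) => h1 h2; nra.
  rewrite !scalerBr addrACA -opprD -scalerDl.
  by rewrite (_ : 2^-1 + (1 - 2^-1) = 1) ?scale1r // addrC subrK.
pose u := lim ((fun k => (wt k).1) @ \oo).
have fsq : (fun k => dotp ((wt k).1 - x) ((wt k).1 - x)) @ \oo --> dotp (u - x) (u - x).
  rewrite /dotp; apply: (cvg_big (op := +%R)) => [|i _]; first exact: add_continuous.
  suff fi : (fun k => ((wt k).1 - x) i 0) @ \oo --> (u - x) i 0 by exact: cvgM.
  under eq_fun do rewrite !mxE.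
  rewrite !mxE; apply: cvgB; last exact: cvg_cst.
  exact: (cvg_comp _ _ wcvg (@coord_continuous R d 1 i 0 u)).
have fval : (fun k => val (wt k).1 (wt k).2) @ \oo --> m.
  apply: (@squeeze_cvgr _ _ _ _ (fun=> m) (fun k => m + 4^-1 * harmonic k)).
  - by apply: nearW => k; have [h1 h2] := wtP k; rewrite mP //= ltW.
  - exact: cvg_cst.
  - rewrite -[X in _ --> X]addr0 -[X in _ + X](mulr0 4^-1).
    by apply: cvgD; [exact: cvg_cst|apply: cvgMr; exact: cvg_harmonic].
(* The limit of the epigraph heights, solved from the limits of the values and of the squared
   distances. *)
pose s := (m - 2^-1 * dotp (u - x) (u - x)) / alpha.
have fs : (fun k => (wt k).2) @ \oo --> s.
  rewrite (_ : (fun k => _) = (fun k =>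
     (val (wt k).1 (wt k).2 - 2^-1 * dotp ((wt k).1 - x) ((wt k).1 - x)) / alpha)).
    by apply: cvgMl; apply: cvgB => //; apply: cvgMr.
  by apply/funext => k; rewrite /val addrK mulrC mulKf // gt_eqF.
have us : (psi u <= s%:E)%E.
  apply: (closed_cvg (fun ut : 'cV[R]_d * R => psi ut.1 <= ut.2%:E)%E clo _ (u, s)
    (cvg_pair wcvg fs)).
  by apply: nearW => k; have [] := wtP k.
exists u => y.
apply: (@le_trans _ _ m%:E).
  rewrite enorm_sqr (_ : m = alpha * s + 2^-1 * dotp (u - x) (u - x)).
    by rewrite EFinD leeD // EFinM lee_pmul2l.
  by rewrite /s mulrCA divff ?gt_eqF // mulr1 subrK.
rewrite enorm_sqr; have := psiNy y.
case py : (psi y) => [t||] // _; last by rewrite gt0_muley ?lte_fin // leey.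
by rewrite -EFinM -EFinD lee_fin mP // py.
Qed.

Lemma ge0_affine_near0 (a b : R) :
  (forall t, 0 < t <= 1 -> 0 <= a + t * b) -> 0 <= a.
Proof.
move=> h; rewrite leNgt; apply/negP => a0.
have h1 : 0 <= a + 1 * b by apply: h; rewrite ltr01 lexx.
have b0 : 0 < b by lra.
(* At this [t] the affine function equals [a / 2 < 0]; [t <= 1] because [0 <= a + b]. *)
have := h (- a / (2 * b)); rewrite divr_gt0 ?mulr_gt0 ?oppr_gt0 //= => /(_ _).
rewrite ler_pdivrMr ?mulr_gt0 // => /(_ ltac:(lra)).
have -> : a + - a / (2 * b) * b = a / 2 by field; rewrite gt_eqF.
by lra.
Qed.

Lemma proper_minimizer_fin (F : 'cV[R]_d -> R) (a : R) psi u : 0 < a ->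
  eproper psi -> minimizer (fun v => a%:E * psi v + (F v)%:E)%E u ->
  exists r, psi u = r%:E.
Proof.
move=> a0 [psiNy [x1 psix1]] umin.
have := umin x1; have := psiNy u; have := psiNy x1; move: psix1.
case: (psi x1) => // s _ _; case: (psi u) => [r _ _|_|//]; first by exists r.
by rewrite gt0_muley ?lte_fin.
Qed.

(** Moving from [u] by [t *: (w - u)] cannot decrease the objective; after division by [t] only the
    quadratic residue depends on [t], and it vanishes as [t] tends to 0. *)
Lemma minimizer_variational (alpha r s : R) psi x u w : 0 < alpha ->
  econvex psi ->
  minimizer (fun v => alpha%:E * psi v + (2^-1 * enorm (v - x) ^+ 2)%:E)%E u ->
  psi u = r%:E -> (psi w <= s%:E)%E ->
  0 <= alpha * (s - r) + dotp (u - x) (w - u).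
Proof.
move=> a0 cvx umin ur ws.
apply: (@ge0_affine_near0 _ (2^-1 * dotp (w - u) (w - u))) => t /andP[t0 t1].
have ur' : (psi u <= r%:E)%E by rewrite ur.
have t01 : 0 <= t <= 1 by rewrite ltW.
set v := t *: w + (1 - t) *: u.
have psiv : (psi v <= (t * s + (1 - t) * r)%:E)%E by exact: econvexP.
have := umin v; rewrite ur -EFinM -EFinD => h.
have : ((alpha * r + 2^-1 * enorm (u - x) ^+ 2)%:E <=
        (alpha * (t * s + (1 - t) * r) + 2^-1 * enorm (v - x) ^+ 2)%:E)%E.
  apply: (le_trans h); rewrite [leRHS]EFinD leeD2r // EFinM.
  by rewrite lee_pmul2l.
rewrite lee_fin !enorm_sqr (_ : v - x = (u - x) + t *: (w - u)); last first.
  by apply/matrixP => i j; rewrite !mxE; ring.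
move: (u - x) (w - u) => D E; rewrite !dotp_lin (dotpC E D) => {}h.
by rewrite -(pmulr_rge0 _ t0); nra.
Qed.

(** Fermat's rule: [- grad F u] is a subgradient of [psi] at [u]. Minimality along the segment to
    [w] bounds the difference quotients of [F] below by [psi u - psi w]. *)
Lemma composite_optimality (F : 'cV[R]_d -> R) psi u : differentiable F u ->
  eproper psi -> econvex psi -> minimizer (fun v => (F v)%:E + psi v)%E u ->
  exists2 c, psi u = c%:E &
    forall w, ((c - dotp (grad F u) (w - u))%:E <= psi w)%E.
Proof.
move=> dF prop cvx umin.
have [c uc] : exists c, psi u = c%:E.
  apply: (proper_minimizer_fin (F := F) ltr01 prop) => w.
  by rewrite !mul1e ![(psi _ + _)%E]addeC.
exists c => // w; have := prop.1 w; case pw : (psi w) => [s||] // _.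
  rewrite lee_fin lerBlDr addrC -lerBlDr -derive_grad //.
  apply: derive_ge => [|t /andP[t0 t1]]; first exact: diff_derivable.
  have t01 : 0 <= t <= 1 by rewrite ltW.
  have uc' : (psi u <= c%:E)%E by rewrite uc.
  have pw' : (psi w <= s%:E)%E by rewrite pw.
  have := econvexP cvx t01 pw' uc'; have := umin (t *: w + (1 - t) *: u).
  rewrite [t *: w + _](_ : _ = u + t *: (w - u)); last first.
    by rewrite scalerBl scale1r scalerBr addrCA.
  rewrite uc -EFinD => h1 h2.
  have := le_trans h1 (leeD2l (F (u + t *: (w - u)))%:E h2).
  by rewrite -EFinD lee_fin => h; nra.
by rewrite leey.
Qed.

(** Since [- gs] is a subgradient at [xs], the point [xs] is the prox of [xs - alpha *: gs]; this is
    nonexpansiveness between that argument and [x]. The subgradient inequality also supplies the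
    affine minorant for existence. *)
Lemma prox_contraction (alpha c : R) psi xs gs x : 0 < alpha ->
  eproper psi -> eclosed psi -> econvex psi -> psi xs = c%:E ->
  (forall w, ((c - dotp gs (w - xs))%:E <= psi w)%E) ->
  enorm (prox alpha psi x - xs) ^+ 2 <= enorm (x - xs + alpha *: gs) ^+ 2.
Proof.
move=> a0 prop clo cvx xsc sub.
have pmin : minimizer (fun u => alpha%:E * psi u +
    (2^-1 * enorm (u - x) ^+ 2)%:E)%E (prox alpha psi x).
  apply: (@prox_minimizer _ (c + dotp gs xs) _ _ (- gs)) => // w.
  by apply: le_trans (sub w); rewrite lee_fin dotpNl dotpBr; lra.
move: (prox _ _ _) pmin => u pmin.
have [r ur] := proper_minimizer_fin a0 prop pmin.
have xsc' : (psi xs <= c%:E)%E by rewrite xsc.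
have := minimizer_variational a0 cvx pmin ur xsc'.
have := sub u; rewrite ur lee_fin.
rewrite (_ : u - x = (u - xs) - (x - xs)); last by rewrite opprB addrA subrK.
rewrite -(opprB u xs) !enorm_sqr; move: (u - xs) (x - xs) => D E.
have := dotp_ge0 (D - (E + alpha *: gs)).
by rewrite !dotp_lin (dotpC E D) (dotpC gs D) (dotpC gs E) => h1 h2 h3; nra.
Qed.

End proximal.

(** * Averages over a finite law on index subsets *)

Section finite_law.
Set Implicit Arguments. Unset Strict Implicit.
Context {R : realType} {n d : nat}.
Variables (pi : {set 'I_n} -> R) (p : 'I_n -> R).
Hypothesis pi_ge0 : forall A, 0 <= pi A.
Hypothesis pi_sum1 : \sum_A pi A = 1.
Hypothesis p_def : forall j, p j = \sum_(A : {set 'I_n} | j \in A) pi A.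

Lemma mean_sum (F : 'I_n -> R) :
  \sum_A pi A * (\sum_(j in A) F j) = \sum_j p j * F j.
Proof.
under eq_bigr do rewrite big_distrr.
rewrite (exchange_big_dep xpredT) //=; apply: eq_bigr => j _.
by rewrite p_def big_distrl.
Qed.

(** Models the table update, where entry [j] is refreshed with probability [p j]. *)
Lemma mean_sum_if (F G : 'I_n -> R) :
  \sum_A pi A * (\sum_j if j \in A then F j else G j) =
  \sum_j (p j * F j + (1 - p j) * G j).
Proof.
transitivity (\sum_A pi A * (\sum_(j in A) (F j - G j)) + \sum_A pi A * \sum_j G j).
  rewrite -big_split; apply: eq_bigr => A _ /=; rewrite -mulrDr; congr (_ * _).
  rewrite [X in X + _]big_mkcond -big_split; apply: eq_bigr => j _ /=.
  by case: ifP; rewrite ?subrK ?add0r.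
rewrite mean_sum -[X in _ + X]big_distrl /= pi_sum1 mul1r -big_split.
apply: eq_bigr => j _ /=.
by ring.
Qed.

Lemma mean_dotp_sum (F : 'I_n -> 'cV[R]_d) z :
  \sum_A pi A * dotp (\sum_(j in A) F j) z = dotp (\sum_j p j *: F j) z.
Proof.
under eq_bigr do rewrite dotp_suml.
by rewrite mean_sum dotp_suml; apply: eq_bigr => j _; rewrite dotpZl.
Qed.

(* Bounds the variance of [\sum_(j in A) c j] by its second moment. *)
Lemma mean_sqr_step (D : 'cV[R]_d) (alpha : R) (a c : 'I_n -> 'cV[R]_d)
    (abar := \sum_j p j *: a j) (cbar := \sum_j p j *: c j) :
  \sum_A pi A * dotp (D - alpha *: (\sum_(j in A) a j - (\sum_(j in A) c j - cbar)))
                     (D - alpha *: (\sum_(j in A) a j - (\sum_(j in A) c j - cbar)))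
  <= dotp D D - 2 * alpha * dotp abar D
     + 2 * alpha ^+ 2 *
       (\sum_A pi A * dotp (\sum_(j in A) a j) (\sum_(j in A) a j) +
        \sum_A pi A * dotp (\sum_(j in A) c j) (\sum_(j in A) c j)).
Proof.
set Ua := fun A : {set 'I_n} => \sum_(j in A) a j.
set Wc := fun A : {set 'I_n} => \sum_(j in A) c j.
(* The parallelogram identity with the square of [U + (W - cbar)] dropped, expanded into terms whose
   means are known. *)
have h (A : {set 'I_n}) : pi A * dotp (D - alpha *: (Ua A - (Wc A - cbar)))
                                      (D - alpha *: (Ua A - (Wc A - cbar))) <=
    pi A * (dotp D D) - 2 * alpha * (pi A * dotp (Ua A) D)
    + 2 * alpha * (pi A * dotp (Wc A) D) - 2 * alpha * (pi A * dotp cbar D)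
    + 2 * alpha ^+ 2 * (pi A * dotp (Ua A) (Ua A))
    + 2 * alpha ^+ 2 * (pi A * dotp (Wc A) (Wc A))
    - 4 * alpha ^+ 2 * (pi A * dotp (Wc A) cbar)
    + 2 * alpha ^+ 2 * (pi A * dotp cbar cbar).
  move: (pi A) (pi_ge0 A) (Ua A) (Wc A) cbar => q q0 U W cb.
  have := mulr_ge0 (mulr_ge0 q0 (sqr_ge0 alpha)) (dotp_ge0 (U + (W - cb))).
  rewrite !dotp_lin (dotpC D U) (dotpC D W) (dotpC D cb) (dotpC W U) (dotpC cb U).
  by rewrite (dotpC cb W) => ?; lra.
apply: (le_trans (ler_sum _ (fun A _ => h A))).
rewrite !(big_split, sumrN) /= -!big_distrr -!big_distrl /= pi_sum1 !mul1r.
rewrite /Ua /Wc !mean_dotp_sum -/abar -/cbar.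
by have := mulr_ge0 (sqr_ge0 alpha) (dotp_ge0 cbar); lra.
Qed.

Variables (M : 'I_n -> 'M[R]_d) (v : 'I_n -> R).
Hypothesis M_psd : forall j, psdmx (M j).
Hypothesis eso : forall h : 'I_n -> 'cV[R]_d,
  \sum_A pi A * enorm (\sum_(j in A) sqrtmx (M j) *m h j) ^+ 2
  <= \sum_j p j * v j * enorm (h j) ^+ 2.

(* The ESO applies because [a j] is [M j ^ 1/2] times [M j ^ 1/2 (M j ^+ a j)]. *)
Lemma eso_in_range (w : 'I_n -> R) (a : 'I_n -> 'cV[R]_d) :
  (forall j, a j = mpinv (M j) *m M j *m a j) ->
  \sum_A pi A * dotp (\sum_(j in A) w j *: a j) (\sum_(j in A) w j *: a j)
  <= \sum_j p j * v j * (w j ^+ 2 * dotp (a j) (mpinv (M j) *m a j)).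
Proof.
move=> aP.
pose h j := w j *: (sqrtmx (M j) *m (mpinv (M j) *m a j)).
(* Transposing the symmetric product [mpinv (M j) *m M j] reverses the two symmetric factors. *)
have MXa j : M j *m (mpinv (M j) *m a j) = a j.
  have [[_ _ _ XM] [Xsym _]] := mpinv_spec (M_psd j).
  by rewrite mulmxA [RHS]aP -XM trmx_mul (M_psd j).1 Xsym.
have hE j : sqrtmx (M j) *m h j = w j *: a j.
  have [_ sq] := sqrtmx_spec (M_psd j).
  by rewrite -scalemxAr !mulmxA sq -mulmxA MXa.
have := eso h; congr (_ <= _).
  by apply: eq_bigr => A _; rewrite enorm_sqr; under eq_bigr do rewrite hE.
apply: eq_bigr => j _; congr (_ * _); rewrite enorm_sqr dotpZl dotpZr mulrA -expr2.
have [[ssym _] sq] := sqrtmx_spec (M_psd j).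
congr (_ * _); rewrite dotp_mulmx ssym (mulmxA (sqrtmx _)) sq MXa //.
Qed.

End finite_law.

(** * Scalar inequalities behind the choice of stepsize and weights *)

Section coefficients.
Context {R : realFieldType}.

(** Here [y] and [z] stand for [q_j a_j] and [q_j c_j]. In the difference of the two sides the
    coefficient of [z] is nonnegative by the stepsize bound, and that of [y] is larger still. *)
Lemma saga_coefficients (n alpha sigma p v y z : R) (w := (n * p)^-1) :
  0 < n -> 0 < alpha -> 0 < sigma -> 0 < p -> 0 <= y -> 0 <= z ->
  alpha * (4 * v + n * sigma) <= n * p ->
  p * ((2 * n * p)^-1 * y) + (1 - p) * ((2 * n * p)^-1 * z) +
  2 * alpha * (p * v * (w ^+ 2 * y)) + 2 * alpha * (p * v * (w ^+ 2 * z)) <=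
  n^-1 * y + (1 - alpha * sigma) * ((2 * n * p)^-1 * z).
Proof.
move=> n0 a0 s0 p0 y0 z0 key.
have np0 : 0 < n * p by exact: mulr_gt0.
have nas : 0 < n * (alpha * sigma) by rewrite !mulr_gt0.
rewrite -subr_ge0.
have -> : n^-1 * y + (1 - alpha * sigma) * ((2 * n * p)^-1 * z) -
  (p * ((2 * n * p)^-1 * y) + (1 - p) * ((2 * n * p)^-1 * z) +
   2 * alpha * (p * v * (w ^+ 2 * y)) + 2 * alpha * (p * v * (w ^+ 2 * z))) =
  ((n * p - 4 * alpha * v) * y +
   (n * p - alpha * (4 * v + n * sigma)) * z) / (2 * n ^+ 2 * p).
  by rewrite /w; field; rewrite !gt_eqF.
rewrite divr_ge0 ?mulr_ge0 ?exprn_ge0 ?(ltW n0) ?(ltW p0) //.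
by rewrite addr_ge0 // mulr_ge0 //; lra.
Qed.

(** [S1] is the mean squared step, [S2] and [S3] second moments with ESO bounds [V1] and [V2], [ip]
    the cross term, and [B1 + B2] the mean new table term. Descent pays [N * Qa], which absorbs the
    variance and the refreshed entries. *)
Lemma saga_combination (alpha sigma DD ip S1 S2 S3 Qa Qc B1 B2 V1 V2 N : R) :
  0 < alpha -> S1 <= DD - 2 * alpha * ip + 2 * alpha ^+ 2 * (S2 + S3) ->
  S2 <= V1 -> S3 <= V2 -> 2^-1 * N * Qa + sigma / 2 * DD <= ip ->
  B1 + B2 + 2 * alpha * V1 + 2 * alpha * V2 <=
    N * Qa + (1 - alpha * sigma) * Qc ->
  S1 + alpha * (B1 + B2) <= (1 - alpha * sigma) * (DD + alpha * Qc).
Proof.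
move=> a0 h1 h2 h3 h4 h5.
have a2 : 0 <= 2 * alpha ^+ 2 by rewrite mulr_ge0 // sqr_ge0.
have := ler_wpM2l (ltW a0) h5; have := ler_wpM2l (ltW a0) h4.
by have := ler_wpM2l a2 (lerD h2 h3); lra.
Qed.

End coefficients.

(** * Contraction of the Lyapunov function in one step *)

Section saga_contraction.
Set Implicit Arguments. Unset Strict Implicit.
Context {R : realType} {n' d : nat}.
Let n := n'.+1.
Variables (f : 'I_n -> 'cV[R]_d -> R) (psi : 'cV[R]_d -> \bar R).
Variables (M : 'I_n -> 'M[R]_d) (sigma : R) (xs : 'cV[R]_d).
Hypothesis f_diff : forall j x, differentiable (f j) x.
Hypothesis f_convex : forall j, convex_function [set: 'cV[R]_d] (f j).
Hypothesis psi_proper : eproper psi.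
Hypothesis psi_closed : eclosed psi.
Hypothesis psi_convex : econvex psi.
Hypothesis xs_min : minimizer (fun x => (favg f x)%:E + psi x)%E xs.
Hypothesis sigma_gt0 : 0 < sigma.
Hypothesis f_qsc : quasi_strongly_convex sigma (favg f) xs.
Hypothesis M_psd : forall j, psdmx (M j).
Hypothesis f_smooth : forall j, matrix_smooth (M j) (f j).
Variables (pi : {set 'I_n} -> R) (p : 'I_n -> R) (v : 'I_n -> R) (alpha : R).
Hypothesis pi_ge0 : forall A, 0 <= pi A.
Hypothesis pi_sum1 : \sum_A pi A = 1.
Hypothesis p_def : forall j, p j = \sum_(A : {set 'I_n} | j \in A) pi A.
Hypothesis p_gt0 : forall j, 0 < p j.
Hypothesis eso : forall h : 'I_n -> 'cV[R]_d,
  \sum_A pi A * enorm (\sum_(j in A) sqrtmx (M j) *m h j) ^+ 2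
  <= \sum_j p j * v j * enorm (h j) ^+ 2.
Hypothesis alpha_gt0 : 0 < alpha.
Hypothesis alpha_le : forall j, alpha * (4 * v j + n%:R * sigma) <= n%:R * p j.

(* Chosen so that [b j ^+ 2 * p j = 1 / (2 n)] for every [j]. *)
Definition saga_weight (j : 'I_n) : R := Num.sqrt (2 * n%:R * p j)^-1.

Lemma favg_differentiable x : differentiable (favg f) x.
Proof.
rewrite (_ : favg f = n%:R^-1 \*: (\sum_(j < n) f j)); last first.
  by apply/funext => y; rewrite /favg /= fct_sumE.
by apply: differentiableZ; apply: differentiable_sum.
Qed.

Lemma grad_favg x : grad (favg f) x = n%:R^-1 *: \sum_(j < n) grad (f j) x.
Proof.
rewrite (_ : favg f = n%:R^-1 \*: (\sum_(j < n) f j)); last first.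
  by apply/funext => y; rewrite /favg /= fct_sumE.
have df j i : derivable (f j) x (delta_mx i 0) by exact: diff_derivable.
apply/matrixP => i k; rewrite !mxE deriveZ; last exact: derivable_sum.
by rewrite derive_sum // summxE; congr (_ * _); apply: eq_bigr => j _; rewrite mxE.
Qed.

Let q j (a : 'cV[R]_d) := dotp a (mpinv (M j) *m a).

Lemma lyapunovE (s : saga_state) : lyapunov f M alpha saga_weight xs s =
  dotp (s.1 - xs) (s.1 - xs) + alpha * \sum_(j < n) (2 * n%:R * p j)^-1 *
    q j (grad (f j) (s.2 j) - grad (f j) xs).
Proof.
rewrite /lyapunov enorm_sqr; congr (_ + _ * _); apply: eq_bigr => j _.
have [[ssym _] sq] := sqrtmx_spec (mpinv_spec (M_psd j)).2.
rewrite enorm_sqr dotp_mulmx ssym mulmxA sq dotpC sqr_sqrtr //.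
by rewrite invr_ge0 !mulr_ge0 // ltW.
Qed.

(** Quasi strong convexity at [x] leaves the Bregman divergence of [favg f] from [xs], which is the
    average of the divergences bounded in [bregman_lower_bound]. *)
Lemma saga_descent (x : 'cV[R]_d) :
  (2 * n%:R)^-1 * \sum_(j < n) q j (grad (f j) x - grad (f j) xs)
  + sigma / 2 * dotp (x - xs) (x - xs)
  <= dotp (grad (favg f) x - grad (favg f) xs) (x - xs).
Proof.
have := f_qsc x; rewrite enorm_sqr -(opprB x xs) dotpNr (dotpBl (grad _ x)) => h.
suff : (2 * n%:R)^-1 * \sum_(j < n) q j (grad (f j) x - grad (f j) xs) <=
    favg f x - favg f xs - dotp (grad (favg f) xs) (x - xs) by lra.
rewrite grad_favg dotpZl dotp_suml /favg -!mulrBr -!sumrB invfM mulrAC [leLHS]mulrC.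
rewrite ler_pM2l ?invr_gt0 ?ltr0n // mulr_sumr; apply: ler_sum => j _.
exact: bregman_lower_bound.
Qed.

Lemma saga_step_contraction (s : saga_state) :
  (forall j, in_range f M xs j s.1) -> (forall j, in_range f M xs j (s.2 j)) ->
  \sum_A pi A * lyapunov f M alpha saga_weight xs (saga_step f psi p alpha s A)
  <= (1 - alpha * sigma) * lyapunov f M alpha saga_weight xs s.
Proof.
case: s => x phi /= xin phin.
pose a j : 'cV[R]_d := grad (f j) x - grad (f j) xs.
pose c j : 'cV[R]_d := grad (f j) (phi j) - grad (f j) xs.
pose w j : R := (n%:R * p j)^-1.
have n0 : 0 < n%:R :> R by rewrite ltr0n.
have pw j : p j * w j = n%:R^-1.
  by rewrite /w invfM mulrCA divff ?mulr1 // gt_eqF.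
have psub (F : 'I_n -> 'cV[R]_d) : \sum_j p j *: (w j *: F j) = n%:R^-1 *: \sum_j F j.
  by rewrite scaler_sumr; apply: eq_bigr => j _; rewrite scalerA pw.
have [cst xsE sub] := composite_optimality (favg_differentiable xs)
  psi_proper psi_convex xs_min.
pose cbar : 'cV[R]_d := \sum_j p j *: (w j *: c j).
pose step (A : {set 'I_n}) : 'cV[R]_d := x - xs - alpha *: (\sum_(j in A) w j *: a j -
   (\sum_(j in A) w j *: c j - cbar)).
have upper A : lyapunov f M alpha saga_weight xs (saga_step f psi p alpha (x, phi) A)
   <= dotp (step A) (step A) + alpha * \sum_(j < n)
      if j \in A then (2 * n%:R * p j)^-1 * q j (a j)
                 else (2 * n%:R * p j)^-1 * q j (c j).
  rewrite lyapunovE /= lerD //; last first.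
    rewrite ler_pM2l //; apply: ler_sum => j _.
    by rewrite /a /c; case: ifP.
  rewrite -!enorm_sqr.
  have /le_trans := prox_contraction (x - alpha *:
     (n%:R^-1 *: \sum_(j < n) grad (f j) (phi j) + \sum_(j in A) w j *:
      (grad (f j) (if j \in A then x else phi j)
       - grad (f j) (phi j)))) alpha_gt0 psi_proper psi_closed psi_convex xsE sub.
  apply; rewrite le_eqVlt; apply/orP; left; apply/eqP; congr (enorm _ ^+ 2).
  (* The shift by [alpha *: grad (favg f) xs] turns the gradient estimator into its centred form
     [U - (W - cbar)], since [cbar] is the mean table gradient minus that at [xs]. *)
  rewrite /step grad_favg /cbar psub /c sumrB (scalerBr n%:R^-1).
  have -> : \sum_(j in A) w j *:
      (grad (f j) (if j \in A then x else phi j)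
       - grad (f j) (phi j)) = \sum_(j in A) w j *: a j - \sum_(j in A) w j *: c j.
    rewrite -sumrB; apply: eq_bigr => j jA.
    by rewrite jA -scalerBr /a /c opprB addrA subrK.
  rewrite -/(c _); move: (\sum_(j in A) _) (\sum_(j in A) _) => u1 u2.
  move: (n%:R^-1 *: _) (n%:R^-1 *: _) => u3 u4.
  by apply/matrixP => i k; rewrite !mxE; ring.
have hsum : \sum_A pi A * lyapunov f M alpha saga_weight xs
      (saga_step f psi p alpha (x, phi) A) <=
   \sum_A pi A * dotp (step A) (step A) + alpha *
     \sum_j (p j * ((2 * n%:R * p j)^-1 * q j (a j)) +
       (1 - p j) * ((2 * n%:R * p j)^-1 * q j (c j))).
  rewrite -(mean_sum_if pi_sum1 p_def) mulr_sumr -big_split /=.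
  apply: ler_sum => A _; rewrite mulrCA -mulrDr.
  by rewrite ler_wpM2l // upper.
apply: (le_trans hsum).
have hstep := mean_sqr_step pi_ge0 pi_sum1 p_def (x - xs) alpha
  (fun j => w j *: a j) (fun j => w j *: c j).
have ua : _ <= \sum_j p j * v j * (w j ^+ 2 * q j (a j)) :=
  eso_in_range M_psd eso w xin.
have uc : _ <= \sum_j p j * v j * (w j ^+ 2 * q j (c j)) :=
  eso_in_range M_psd eso w phin.
have desc := saga_descent x.
rewrite lyapunovE /=.
(* Unbiasedness: the cross term of [hstep] becomes the inner product bounded by [desc]. *)
have abarE : \sum_j p j *: (w j *: a j) = grad (favg f) x - grad (favg f) xs.
  by rewrite psub !grad_favg -scalerBr -sumrB.
rewrite abarE in hstep.
have coef j : p j * ((2 * n%:R * p j)^-1 * q j (a j)) +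
       (1 - p j) * ((2 * n%:R * p j)^-1 * q j (c j)) +
   2 * alpha * (p j * v j * (w j ^+ 2 * q j (a j))) +
   2 * alpha * (p j * v j * (w j ^+ 2 * q j (c j))) <=
   n%:R^-1 * q j (a j) + (1 - alpha * sigma) * ((2 * n%:R * p j)^-1 * q j (c j)).
  apply: saga_coefficients => //; exact: (mpinv_spec (M_psd j)).2.2.
pose B1 := \sum_j p j * ((2 * n%:R * p j)^-1 * q j (a j)).
pose B2 := \sum_j (1 - p j) * ((2 * n%:R * p j)^-1 * q j (c j)).
pose Qc := \sum_j (2 * n%:R * p j)^-1 * q j (c j).
have hc : B1 + B2 + 2 * alpha * (\sum_j p j * v j * (w j ^+ 2 * q j (a j)))
    + 2 * alpha * (\sum_j p j * v j * (w j ^+ 2 * q j (c j)))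
  <= n%:R^-1 * (\sum_j q j (a j)) + (1 - alpha * sigma) * Qc.
  rewrite /B1 /B2 /Qc !mulr_sumr -!big_split; apply: ler_sum => j _.
  exact: coef.
have -> : \sum_j (p j * ((2 * n%:R * p j)^-1 * q j (a j)) +
       (1 - p j) * ((2 * n%:R * p j)^-1 * q j (c j))) = B1 + B2.
  by rewrite /B1 /B2 -big_split.
rewrite invfM in desc.
exact: (saga_combination alpha_gt0 hstep ua uc desc hc).
Qed.

End saga_contraction.

(** * Finitely valued random variables and independence of the past *)

Section finite_expectation.
Set Implicit Arguments. Unset Strict Implicit.
Context {disp : measure_display} {T : measurableType disp} {R : realType}.
Variable (P : probability T R).

Definition atom_prob (I : finType) (X : T -> I) (i : I) : R :=
  fine (P (X @^-1` [set i])).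

Lemma atom_prob_ge0 (I : finType) (X : T -> I) i : 0 <= atom_prob X i.
Proof. exact/fine_ge0/measure_ge0. Qed.

(** [F] composed with [X] is a finite combination of indicators of fibres, and nonnegativity allows
    termwise integration. *)
Lemma expectation_finite (I : finType) (X : T -> I) (F : I -> R) :
  (forall i, measurable (X @^-1` [set i])) -> (forall i, 0 <= F i) ->
  ('E_P[fun w => F (X w)] = (\sum_i atom_prob X i * F i)%:E)%E.
Proof.
move=> mX F0; rewrite unlock.
transitivity (\int[P]_w \sum_(i <- index_enum I)
    ((F i)%:E * (\1_(X @^-1` [set i]) w)%:E))%E.
  apply: eq_integral => w _; rewrite (bigD1 (X w)) //= big1 => [|i iX].
    by rewrite indicE mem_set //= mule1 adde0.
  by rewrite indicE memNset ?mule0 //= => e; move: iX; rewrite e eqxx.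
rewrite ge0_integral_sum //; last 2 first.
- by move=> i; apply: measurable_funeM; apply/measurable_EFinP; exact: measurable_indic.
- by move=> i w _; rewrite mule_ge0 // lee_fin.
rewrite -sumEFin; apply: eq_bigr => i _.
have mi : measurable_fun setT (fun w => (\1_(X @^-1` [set i]) w)%:E : \bar R).
  by apply/measurable_EFinP; exact: measurable_indic.
rewrite ge0_integralZl_EFin //.
rewrite integral_indic // setIT EFinM muleC fineK //.
exact: fin_num_measure.
Qed.

Lemma atom_prob_sum1 (I : finType) (X : T -> I) :
  (forall i, measurable (X @^-1` [set i])) -> \sum_i atom_prob X i = 1.
Proof.
move=> mX; apply: EFin_inj; rewrite -(expectation_cst P 1).
have := expectation_finite (F := fun=> 1) mX (fun=> ler01); rewrite [LHS]/=.
move=> ->; congr _%:E; apply: eq_bigr => i _.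
by rewrite mulr1.
Qed.

Lemma fine_prob_finite (I : finType) (X : T -> I) (B : pred I) :
  (forall i, measurable (X @^-1` [set i])) ->
  fine (P [set w | B (X w)]) = \sum_(i | B i) atom_prob X i.
Proof.
move=> mX; have mB : measurable [set w | B (X w)].
  rewrite (_ : [set w | _] = \bigcup_(i in [set` B]) (X @^-1` [set i])).
    by apply: fin_bigcup_measurable.
  by apply/seteqP; split=> [w Bw|w [i Bi /= e]]; [exists (X w)|rewrite e].
have := expectation_finite (F := fun i => (B i)%:R) mX (fun i => ler0n _ _).
rewrite unlock.
rewrite (_ : (fun w => _) = (fun w => (\1_[set w | B (X w)] w)%:E)); last first.
  apply/funext => w; rewrite indicE; congr ((nat_of_bool _)%:R)%:E.
  by apply/idP/idP; rewrite inE.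
rewrite integral_indic // setIT => -> /=; rewrite [RHS]big_mkcond.
by apply: eq_bigr => i _; case: (B i); rewrite ?mulr1 ?mulr0.
Qed.

Variables (n : nat) (Rs : nat -> T -> {set 'I_n}).
Hypothesis Rs_random : forall k, random_subset (Rs k).
Hypothesis Rs_indep : independent_of_past P Rs.

(** The past as an element of a finite type, so that conditioning on it is a finite sum. *)
Definition history k (w : T) : {ffun 'I_k -> {set 'I_n}} := [ffun i => Rs (val i) w].

(** Gives [saga] the infinite sequence it expects; the empty set from [k] on is a filler that the
    first [k] steps never read. *)
Definition extend_history k (h : {ffun 'I_k -> {set 'I_n}}) (i : nat) : {set 'I_n} :=
  if insub i is Some i' then h i' else finset.set0.

Lemma extend_historyE k w i : (i < k)%N -> extend_history (history k w) i = Rs i w.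
Proof. by move=> ik; rewrite /extend_history insubT ffunE. Qed.

Lemma history_fiber k h :
  history k @^-1` [set h] =
  [set w | forall i, (i < k)%N -> Rs i w = extend_history h i].
Proof.
apply/seteqP; split=> w /= => [<- i ik|hw]; first by rewrite extend_historyE.
apply/ffunP => i; rewrite ffunE hw ?ltn_ord // /extend_history.
case: insubP => [i' _ ii'|]; last by rewrite ltn_ord.
by congr (h _); exact/val_inj.
Qed.

Lemma measurable_history k h : measurable (history k @^-1` [set h]).
Proof.
rewrite history_fiber.
rewrite (_ : [set w | _] =
    \bigcap_(i in `I_k) (Rs i @^-1` [set extend_history h i])).
  by apply: fin_bigcap_measurable => // i _; exact: Rs_random.
by apply/seteqP; split=> w hw i; exact: hw.
Qed.

Lemma atom_prob_history k h A :
  atom_prob (fun w => (history k w, Rs k w)) (h, A) =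
  atom_prob (history k) h * atom_prob (Rs k) A.
Proof.
rewrite /atom_prob -fineM ?fin_num_measure //; last 2 first.
- exact: measurable_history.
- exact: Rs_random.
rewrite history_fiber -Rs_indep -history_fiber; congr (fine (P _)).
by apply/seteqP; split=> w /= => [[-> ->]|[-> ->]].
Qed.

(** Conditioning on the past: by independence the joint atoms factor, and the new draw is averaged
    with the history frozen. *)
Lemma expectation_history k (F : {ffun 'I_k -> {set 'I_n}} -> {set 'I_n} -> R) :
  (forall h A, 0 <= F h A) ->
  ('E_P[fun w => F (history k w) (Rs k w)] =
   (\sum_h atom_prob (history k) h *
     \sum_A atom_prob (Rs k) A * F h A)%:E)%E.
Proof.
move=> F0; rewrite (@expectation_finite _ (fun w => (history k w, Rs k w))
  (fun hA => F hA.1 hA.2)) //; last first.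
  move=> [h A]; rewrite (_ : _ @^-1` _ =
      history k @^-1` [set h] `&` Rs k @^-1` [set A]).
    by apply: measurableI; [exact: measurable_history|exact: Rs_random].
  by apply/seteqP; split=> w /= => [[-> ->]|[-> ->]].
congr _%:E; under [RHS]eq_bigr do rewrite mulr_sumr.
rewrite pair_bigA /=; apply: eq_bigr => -[h A] _.
by rewrite atom_prob_history mulrA.
Qed.

(** An atom of positive probability is not contained in a null set. This brings the almost sure
    range condition to each history that matters. *)
Lemma ae_history k h (Q : T -> Prop) : {ae P, forall w, Q w} ->
  atom_prob (history k) h != 0 -> exists2 w, history k w = h & Q w.
Proof.
move=> [N [mN PN QN]] h0; apply: contrapT => noQ.
move/eqP: h0; apply; rewrite /atom_prob.
suff -> : P (history k @^-1` [set h]) = 0%E by [].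
apply/eqP; rewrite -measure_le0 -PN le_measure ?inE //.
  exact: measurable_history.
by move=> w hw; apply: QN => Qw; apply: noQ; exists w.
Qed.

End finite_expectation.

(** * Trajectories, the Lyapunov function and the geometric rate *)

Section saga_rate.
Set Implicit Arguments. Unset Strict Implicit.
Context {R : realType} {n' : nat}.
Let n := n'.+1.

Lemma min_ord_attained (F : 'I_n -> R) : exists j, min_ord F = F j.
Proof.
apply: (big_ind (fun x => exists j, x = F j)) => [|x y [i ->] [j ->]|i _].
- by exists ord0.
- by rewrite minEle; case: ifP; [exists i|exists j].
- by exists i.
Qed.

Lemma sagaS d (f : 'I_n -> 'cV[R]_d -> R) psi p alpha x0 A k :
  saga f psi p alpha x0 A k.+1 =
  saga_step f psi p alpha (saga f psi p alpha x0 A k) (A k).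
Proof. by []. Qed.

Lemma saga_prefix d (f : 'I_n -> 'cV[R]_d -> R) psi p alpha x0 A B k :
  (forall i, (i < k)%N -> A i = B i) ->
  saga f psi p alpha x0 A k = saga f psi p alpha x0 B k.
Proof.
elim: k => // k IH AB /=; rewrite AB // IH // => i ik.
by apply: AB; exact: ltnW.
Qed.

Lemma lyapunov_ge0 d (f : 'I_n -> 'cV[R]_d -> R) M alpha b xs s :
  0 <= alpha -> 0 <= lyapunov f M alpha b xs s.
Proof.
move=> a0; rewrite addr_ge0 ?sqr_ge0 // mulr_ge0 // sumr_ge0 // => j _.
by rewrite mulr_ge0 // sqr_ge0.
Qed.

Lemma lyapunov_dim0 (f : 'I_n -> 'cV[R]_0 -> R) M alpha b xs s :
  lyapunov f M alpha b xs s = 0.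
Proof.
have e (y : 'cV[R]_0) : enorm y ^+ 2 = 0 by rewrite enorm_sqr /dotp big_ord0.
rewrite /lyapunov e big1 ?mulr0 ?addr0 // => j _.
by rewrite e mulr0.
Qed.

(** Uses [1 - r <= expR (- r)], raised to the power [k]. *)
Lemma geometric_le_eps (r eps : R) k : 0 <= r <= 1 -> 0 < eps ->
  ln (1 / eps) <= r * k%:R -> (1 - r) ^+ k <= eps.
Proof.
move=> /andP[r0 r1] e0 h; apply: (@le_trans _ _ (expR (k%:R * - r))).
  rewrite expRM_natl lerXn2r ?nnegrE ?subr_ge0 ?expR_ge0 //.
  exact: expR_ge1Dx.
rewrite -[leRHS]lnK ?posrE // ler_expR.
by move: h; rewrite div1r lnV ?posrE //; lra.
Qed.

End saga_rate.

(** * Consequences of the ESO inequality for the finite law *)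

Section saga_complexity.
Set Implicit Arguments. Unset Strict Implicit.
Context {R : realType} {n' d : nat}.
Let n := n'.+1.
Context {disp : measure_display} {T : measurableType disp} (P : probability T R).
Variables (p v : 'I_n -> R) (S : T -> {set 'I_n}) (M : 'I_n -> 'M[R]_d).
Hypothesis S_random : random_subset S.
Hypothesis p_gt0 : forall j, 0 < p j.
Hypothesis v_eso : forall h : 'I_n -> 'cV[R]_d,
    ('E_P[fun w => (enorm (\sum_(j in S w) sqrtmx (M j) *m h j) ^+ 2)%R]
     <= (\sum_(j < n) p j * v j * enorm (h j) ^+ 2)%:E)%E.

Lemma eso_finite (h : 'I_n -> 'cV[R]_d) :
  \sum_A atom_prob P S A * enorm (\sum_(j in A) sqrtmx (M j) *m h j) ^+ 2
  <= \sum_j p j * v j * enorm (h j) ^+ 2.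
Proof.
have := v_eso h; rewrite (expectation_finite P
  (F := fun A : {set 'I_n} => enorm (\sum_(j in A) sqrtmx (M j) *m h j) ^+ 2) S_random).
  by rewrite lee_fin.
by move=> A; exact: sqr_ge0.
Qed.

(** The ESO is tested on a family supported at [j]; positive dimension makes the all-ones vector
    nonzero. *)
Lemma eso_coef_ge0 j : (0 < d)%N -> 0 <= v j.
Proof.
move=> d0; pose h i : 'cV[R]_d := if i == j then const_mx 1 else 0.
have hE : \sum_i p i * v i * enorm (h i) ^+ 2 =
    p j * v j * enorm (const_mx 1 : 'cV[R]_d) ^+ 2.
  rewrite (bigD1 j) //= /h eqxx big1 ?addr0 // => i /negPf ->.
  by rewrite enorm_sqr dotp0l mulr0.
have : 0 <= p j * v j * enorm (const_mx 1 : 'cV[R]_d) ^+ 2.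
  rewrite -hE; apply: le_trans (eso_finite h); apply: sumr_ge0 => A _.
  by rewrite mulr_ge0 ?sqr_ge0 // atom_prob_ge0.
rewrite pmulr_lge0 ?pmulr_rge0 // enorm_sqr /dotp.
under eq_bigr do rewrite !mxE mulr1.
by rewrite sumr_const card_ord ltr0n.
Qed.

End saga_complexity.
Theorem corollaryG2 (R : realType) (n' d : nat) (n := n'.+1)
  (f : 'I_n -> 'cV[R]_d -> R) (psi : 'cV[R]_d -> \bar R)
  (M : 'I_n -> 'M[R]_d) (sigma : R) (xs : 'cV[R]_d)
  (f_diff : forall j x, differentiable (f j) x)
  (f_convex : forall j, convex_function [set: 'cV[R]_d] (f j))
  (psi_proper : eproper psi) (psi_closed : eclosed psi)
  (psi_convex : econvex psi)
  (xs_min : unique_minimizer (fun x => (favg f x)%:E + psi x)%E xs)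
  (sigma_gt0 : 0 < sigma)
  (f_qsc : quasi_strongly_convex sigma (favg f) xs)
  (M_psd : forall j, psdmx (M j))
  (f_smooth : forall j, matrix_smooth (M j) (f j))
  (disp : measure_display) (T : measurableType disp) (P : probability T R)
  (S : T -> {set 'I_n}) (S_random : random_subset S)
  (p := inclusion_prob P S) (p_gt0 : forall j, 0 < p j)
  (v : 'I_n -> R)
  (v_eso : forall h : 'I_n -> 'cV[R]_d,
    ('E_P[fun w => (enorm (\sum_(j in S w) sqrtmx (M j) *m h j) ^+ 2)%R]
     <= (\sum_(j < n) p j * v j * enorm (h j) ^+ 2)%:E)%E)
  (Rs : nat -> T -> {set 'I_n})
  (Rs_random : forall k, random_subset (Rs k))
  (Rs_law : forall k, same_law P (Rs k) S)
  (Rs_indep : independent_of_past P Rs)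
  (x0 : 'cV[R]_d)
  (alpha := min_ord (fun j => n%:R * p j / (4 * v j + n%:R * sigma)))
  (iter := fun (k : nat) (w : T) => saga f psi p alpha x0 (Rs ^~ w) k)
  (standing : {ae P, forall w, forall (k : nat) (j : 'I_n),
    in_range f M xs j (iter k w).1 /\ in_range f M xs j ((iter k w).2 j)}) :
  exists b : 'I_n -> R, (forall j, 0 < b j) /\
    let Psi := lyapunov f M alpha b xs in
    forall (eps : R) (k : nat), 0 < eps < 1 ->
      max_ord (fun j => (4 * v j + n%:R * sigma) / (n%:R * sigma * p j))
        * ln (1 / eps) <= k%:R ->
      ('E_P[fun w => Psi (iter k w)] <= (eps * Psi (saga_init x0))%:E)%E.
Proof.
(* In dimension 0 the ESO says nothing about the sign of [v], hence of [alpha], but the Lyapunov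
   function vanishes. *)
have [d0|d_gt0] := posnP d.
  exists (fun=> 1); split=> // Psi eps k /andP[eps0 _] _; subst d.
  rewrite /Psi lyapunov_dim0 mulr0.
  under eq_fun do rewrite lyapunov_dim0.
  by rewrite (expectation_cst P 0).
pose pi := atom_prob P S.
have v_ge0 j : 0 <= v j := eso_coef_ge0 S_random p_gt0 v_eso j d_gt0.
have n_gt0 : 0 < n%:R :> R by rewrite ltr0n.
have den_gt0 j : 0 < 4 * v j + n%:R * sigma.
  by rewrite ltr_wpDl ?mulr_ge0 ?mulr_gt0.
have alpha_gt0 : 0 < alpha.
  have [j] := min_ord_attained (fun j => n%:R * p j / (4 * v j + n%:R * sigma)).
  by rewrite -/alpha => ->; rewrite divr_gt0 // mulr_gt0.
have alpha_le j : alpha * (4 * v j + n%:R * sigma) <= n%:R * p j.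
  by rewrite -ler_pdivlMr //; exact: bigmin_le.
have pE j : p j = \sum_(A : {set 'I_n} | j \in A) pi A.
  exact: (fine_prob_finite P (fun A : {set 'I_n} => j \in A) S_random).
have pi_ge0 A : 0 <= pi A := atom_prob_ge0 P S A.
have pi_sum1 : \sum_A pi A = 1 := atom_prob_sum1 P S_random.
(* The upper bound is [n * alpha * sigma <= alpha * (4 * v j + n * sigma) <= n * p j <= n] at
   [j = ord0]. *)
have rate01 : 0 <= alpha * sigma <= 1.
  rewrite mulr_ge0 ?(ltW alpha_gt0) ?(ltW sigma_gt0) //=.
  have p1 : p ord0 <= 1.
    rewrite pE -pi_sum1 [leRHS](bigID (fun A : {set 'I_n} => ord0 \in A)) /=.
    by rewrite lerDl sumr_ge0.
  rewrite -(ler_pM2l n_gt0) mulr1.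
  apply: (@le_trans _ _ (n%:R * p ord0)); last by rewrite ler_piMr // ltW.
  apply: le_trans (alpha_le ord0); rewrite mulrDr [leRHS]addrC.
  by rewrite mulrCA lerDl !mulr_ge0 ?(ltW alpha_gt0).
pose b := saga_weight p.
exists b; split=> [j|Psi eps k /andP[eps0 eps1] hk].
  by rewrite sqrtr_gt0 invr_gt0 !mulr_gt0.
have Psi_ge0 s : 0 <= Psi s by apply: lyapunov_ge0; exact: ltW.
(* The state after [m] steps depends on the first [m] draws only, so expectations become the finite
   sums [e m]. *)
pose st m (h : {ffun 'I_m -> {set 'I_n}}) := saga f psi p alpha x0 (extend_history h) m.
have stE m w : st m (history Rs m w) = iter m w.
  by apply: saga_prefix => i im; rewrite extend_historyE.
pose e m := \sum_h atom_prob P (history Rs m) h * Psi (st m h).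
have EE m : 'E_P[fun w => Psi (iter m w)]%E = (e m)%:E.
  under eq_fun do rewrite -stE.
  apply: (expectation_finite P (F := fun h => Psi (st m h))) => // h.
  exact: measurable_history.
have e0 : e 0%N = Psi (saga_init x0).
  apply: EFin_inj; rewrite -EE; exact: (expectation_cst P (Psi (saga_init x0))).
have eS m : e m.+1 <= (1 - alpha * sigma) * e m.
  have EH := expectation_history Rs_random Rs_indep
    (F := fun h A => Psi (saga_step f psi p alpha (st m h) A)) (fun h A => Psi_ge0 _).
  have fE : (fun w => Psi (iter m.+1 w)) =
      (fun w => Psi (saga_step f psi p alpha (st m (history Rs m w)) (Rs m w))).
    apply/funext => w.
    have iterS : iter m.+1 w = saga_step f psi p alpha (iter m w) (Rs m w).
      exact: sagaS.
    exact: (etrans (congr1 Psi iterS)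
      (congr1 (fun s => Psi (saga_step f psi p alpha s (Rs m w))) (esym (stE m w)))).
  have -> : e m.+1 = \sum_h atom_prob P (history Rs m) h *
     \sum_A atom_prob P (Rs m) A * Psi (saga_step f psi p alpha (st m h) A).
    exact: EFin_inj (etrans (esym (EE m.+1)) (etrans (congr1 (expectation P) fE) EH)).
  rewrite mulr_sumr; apply: ler_sum => h _.
  (* Null histories contribute nothing; any other contains an outcome satisfying the standing
     assumption, and the one-step contraction applies there. *)
  have [->|h0] := eqVneq (atom_prob P (history Rs m) h) 0.
    by rewrite !mul0r mulr0.
  have [w wh Qw] := ae_history Rs_random standing h0.
  have -> : atom_prob P (Rs m) = pi.
    by apply/funext => A; exact: (congr1 fine (Rs_law m A)).
  rewrite [leRHS]mulrCA; apply: ler_wpM2l; first exact: atom_prob_ge0.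
  apply: (saga_step_contraction f_diff f_convex psi_proper psi_closed psi_convex
    xs_min.1 sigma_gt0 f_qsc M_psd f_smooth pi_ge0 pi_sum1 pE p_gt0
    (eso_finite S_random v_eso) alpha_gt0 alpha_le) => j;
    rewrite -wh stE; by have [] := Qw m j.
have ek : e k <= (1 - alpha * sigma) ^+ k * Psi (saga_init x0).
  elim: k {hk} => [|m IH]; first by rewrite e0 expr0 mul1r.
  apply: (le_trans (eS m)); rewrite exprS -mulrA ler_wpM2l //.
  by rewrite subr_ge0; case/andP: rate01.
rewrite EE lee_fin; apply: (le_trans ek); apply: ler_wpM2r => //.
apply: geometric_le_eps => //.
(* At an index attaining the minimum, [1 / (alpha * sigma)] is exactly one of the terms under the
   maximum. *)
have [j aj] := min_ord_attained (fun j => n%:R * p j / (4 * v j + n%:R * sigma)).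
rewrite -ler_pdivrMl ?mulr_gt0 //; apply: le_trans hk.
rewrite ler_wpM2r //.
  by rewrite ln_ge0 // div1r invr_ge1 ?ltW // unitfE gt_eqF.
apply: le_trans (le_bigmax _ _ j); rewrite /alpha aj invfM invf_div.
by rewrite le_eqVlt; apply/orP; left; apply/eqP; field; rewrite !gt_eqF.
Qed.
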